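(* Let $\mathfrak{g}$ be a two-step nilpotent Lie group with the Campbell-Hausdorff multiplication $x\circ y=x+y+\frac12[x,y]$, of dimension $d$, and let $f_1,\dots,f_n$ ($n\ge1$) be Schwartz functions on $\mathfrak{g}$. For every $\alpha\in\mathbb{N}^d$, $$T^{\alpha}(f_1*\cdots*f_n)=\sum_{\beta^1+\cdots+\beta^n+\tau_{[0]}=\alpha}\binom{\alpha}{\beta^1\dots\beta^n}_{\tau}\,\tilde c_{\tau}\;T^{\beta^1+\tau_{[1]}}f_1*\cdots*T^{\beta^n+\tau_{[n]}}f_n,$$ where the sum runs over all $\beta^1,\dots,\beta^n\in\mathbb{N}^d$ and $\tau\in\mathbb{N}^{D^{(n)}}$ with $\beta^1+\cdots+\beta^n+\tau_{[0]}=\alpha$.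
   Context: $\mathbb{N}$ contains $0$. $\mathfrak{g}$ is a real two-step nilpotent Lie algebra of dimension $d$, endowed with dilations $(\delta_t)_{t>0}$ (one-parameter group of automorphisms) with exponents of homogeneity $1,2$, i.e. $\mathfrak{g}=\mathfrak{g}_1\oplus\mathfrak{g}_2$ with $\mathfrak{g}_j=\{x:\delta_t(x)=t^jx \text{ for all } t>0\}$. The vector space $\mathfrak{g}$ is also a Lie group with multiplication $x\circ y=x+y+\frac12[x,y]$ (so $y^{-1}=-y$). Fix a basis $X_1,\dots,X_d$ of $\mathfrak{g}$, write $x=\sum_i x_iX_i$, and define structure constants by $[X_i,X_j]=\sum_{k=1}^d a_{i,j,k}X_k$. A (normalized) Lebesgue measure $dx$ on $\mathfrak{g}$ is a Haar measure, and the convolution is $f*g(x)=\int_{\mathfrak{g}}f(x\circ y^{-1})g(y)\,dy$. For a multiindex $\alpha$, $T^\alpha f(x)=x_1^{\alpha_1}\cdots x_d^{\alpha_d}f(x)$. Let $D^{(n)}=\{(i,j,k,r,s):a_{i,j,k}\neq0,\ 1\le r<s\le n\}$. For $\tau\in\mathbb{N}^{D^{(n)}}$ define multiindices in $\mathbb{N}^d$ by $$\tau_{[0],k}=\sum_{i,j,r,s}\tau_{(i,j,k,r,s)},\quad k=1,\dots,d,$$ $$\tau_{[m],l}=\sum_{j,k,s}\tau_{(l,j,k,m,s)}+\sum_{i,k,r}\tau_{(i,l,k,r,m)},\quad m=1,\dots,n,\ l=1,\dots,d,$$ (sums over indices for which the quintuple lies in $D^{(n)}$). For $\alpha,\beta^1,\dots,\beta^n\in\mathbb{N}^d$,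 $\tau\in\mathbb{N}^{D^{(n)}}$ with $\sum_{m=1}^n\beta^m+\tau_{[0]}=\alpha$ put $$\binom{\alpha}{\beta^1\dots\beta^n}_\tau=\frac{\alpha!}{\beta^1!\cdots\beta^n!\,\tau!},\qquad \tilde c_\tau=2^{-\sum_{i,j,k,r,s}\tau_{(i,j,k,r,s)}}\prod_{i,j,k,r,s}a_{i,j,k}^{\tau_{(i,j,k,r,s)}},$$ where factorials of multiindices are products of the factorials of their entries. *)

(* Defs.v *)
From HB Require Import structures.
From mathcomp Require Import all_boot all_order all_algebra.
From mathcomp Require Import all_classical all_reals all_analysis.
From mathcomp Require Import complex.

Set Implicit Arguments.
Unset Strict Implicit.
Unset Printing Implicit Defensive.

Import Order.TTheory GRing.Theory Num.Theory.
Import numFieldNormedType.Exports.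

Local Open Scope classical_set_scope.
Local Open Scope ring_scope.
Local Open Scope complex_scope.

(** * Lebesgue measure on R^n

    The Borel space R^n is [n.-tuple (measurableTypeR R)] with its product
    sigma-algebra.  The measure is built by recursion on n: a point mass on
    R^0, then the image of lebesgue_measure \x (Lebesgue measure on R^n) under
    (x, t) |-> x :: t. *)

Notation Rtuple R n := (n.-tuple (measurableTypeR R)).

Section lebesgue_tuple_step.
Context {R : realType} (n : nat).
Variable mu : {sigma_finite_measure set (Rtuple R n) -> \bar R}.

Definition tcons (p : measurableTypeR R * Rtuple R n) : Rtuple R n.+1 :=
  [tuple of p.1 :: p.2].

Lemma measurable_tcons : measurable_fun setT tcons.
Proof. exact: measurable_cons. Qed.

Definition lebesgue_tuple_step : set (Rtuple R n.+1) -> \bar R :=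
  pushforward (lebesgue_measure \x mu)%E tcons.

Let step0 : lebesgue_tuple_step set0 = 0%E.
Proof. by rewrite /lebesgue_tuple_step /pushforward preimage_set0 measure0. Qed.

Let step_ge0 A : (0 <= lebesgue_tuple_step A)%E.
Proof. by rewrite /lebesgue_tuple_step /pushforward measure_ge0. Qed.

Let measurable_tcons_preimage A : measurable A -> measurable (tcons @^-1` A).
Proof. by move=> mA; rewrite -[X in measurable X]setTI; exact: measurable_tcons. Qed.

Let step_sigma_additive : semi_sigma_additive lebesgue_tuple_step.
Proof.
move=> F mF tF mUF; rewrite /lebesgue_tuple_step /pushforward preimage_bigcup.
apply: measure_semi_sigma_additive.
- by move=> k; exact: measurable_tcons_preimage.
- apply/trivIsetP => /= i j _ _ ij; rewrite -preimage_setI.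
  by move/trivIsetP : tF => /(_ _ _ _ _ ij) ->//; rewrite preimage_set0.
- by rewrite -preimage_bigcup; exact: measurable_tcons_preimage.
Qed.

HB.instance Definition _ := isMeasure.Build _ _ _ lebesgue_tuple_step
  step0 step_ge0 step_sigma_additive.

Let step_sigma_finite : sigma_finite setT lebesgue_tuple_step.
Proof.
have /sigma_finiteP[F [TF ndF Foo]] := sigma_finiteT (@lebesgue_measure R).
have /sigma_finiteP[G [TG ndG Goo]] := sigma_finiteT mu.
pose tl (t : Rtuple R n.+1) : Rtuple R n := [tuple of behead t].
have tlK x t : tl (tcons (x, t)) = t by exact: val_inj.
have mtl : measurable_fun setT tl by exact: measurable_behead.
have mhd : measurable_fun setT (fun t : Rtuple R n.+1 => thead t).
  exact: (measurable_tnth ord0).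
pose box k : set (Rtuple R n.+1) :=
  [set t | F k (thead t) /\ G k (tl t)].
have box_tcons k : tcons @^-1` box k = F k `*` G k.
  by apply/seteqP; split=> -[x t]; rewrite /box /= tlK theadE.
exists box => [|k].
  apply/esym; rewrite -subTset => t _.
  have [i _ Fi] : (\bigcup_i F i) (thead t) by rewrite -TF.
  have [j _ Gj] : (\bigcup_i G i) (tl t) by rewrite -TG.
  exists (maxn i j) => //; split.
    by move: Fi; exact/subsetPset/ndF/leq_maxl.
  by move: Gj; exact/subsetPset/ndG/leq_maxr.
have [mF Fk] := Foo k; have [mG Gk] := Goo k; split.
  by apply: measurableI; rewrite -[X in measurable X]setTI; [exact: mhd|exact: mtl].
rewrite /lebesgue_tuple_step /pushforward box_tcons.
by rewrite product_measure1E// lte_mul_pinfty// ge0_fin_numE.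
Qed.

HB.instance Definition _ := Measure_isSigmaFinite.Build _ _ _
  lebesgue_tuple_step step_sigma_finite.

End lebesgue_tuple_step.

Fixpoint lebesgue_tuple (R : realType) (n : nat) :
    {sigma_finite_measure set (Rtuple R n) -> \bar R} :=
  match n with
  | 0%N => \d_([tuple] : Rtuple R 0)
  | m.+1 => lebesgue_tuple_step (lebesgue_tuple R m)
  end.

(** * Two-step nilpotent Lie algebras with dilations *)

Section lie.
Context {R : realType} {g : vectType R}.
Implicit Types (br : g -> g -> g) (delta : R -> g -> g).

Record lie_bracket br : Prop := LieBracket {
  lie_linearl : forall y, linear (br^~ y);
  lie_linearr : forall x, linear (br x);
  lie_alternating : forall x, br x x = 0;
  lie_jacobi : forall x y z, br x (br y z) + br y (br z x) + br z (br x y) = 0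
}.

(** Nilpotency class at most two; abelian algebras are not excluded. *)
Definition two_step_nilpotent br := forall x y z, br (br x y) z = 0.

Definition homogeneous delta (j : nat) (x : g) :=
  forall t, 0 < t -> delta t x = t ^+ j *: x.

(** A one-parameter group of automorphisms indexed by t > 0 (the values of
    [delta] at t <= 0 are irrelevant), g being the direct sum of the
    homogeneous subspaces of degrees 1 and 2.  Bijectivity of [delta t] follows
    from the group law. *)
Record dilations br delta : Prop := Dilations {
  dil_linear : forall t, 0 < t -> linear (delta t);
  dil_bracket : forall t, 0 < t ->
    forall x y, delta t (br x y) = br (delta t x) (delta t y);
  dil_one : forall x, delta 1 x = x;
  dil_mul : forall s t, 0 < s -> 0 < t ->
    forall x, delta (s * t) x = delta s (delta t x);
  dil_direct_sum : forall x, exists! p : g * g,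
    [/\ homogeneous delta 1 p.1, homogeneous delta 2 p.2 & x = p.1 + p.2]
}.

Definition lie_mul br (x y : g) : g := x + y + 2^-1 *: br x y.

Definition lie_inv (x : g) : g := - x.

End lie.

(** * Coordinates, Schwartz functions and convolution *)

Section functions.
Context {R : realType} {g : vectType R} {d : nat}.
Variable X : d.-tuple g.

Definition point (x : 'I_d -> R) : g := \sum_(i < d) x i *: tnth X i.

(** Partial derivatives of a real function on R^d: [partials s F] is
    F differentiated successively in the directions listed in [s]. *)
Definition partial (i : 'I_d) (F : 'rV[R]_d -> R) : 'rV[R]_d -> R :=
  fun x => 'D_(delta_mx 0 i) F x.

Definition partials (s : seq 'I_d) (F : 'rV[R]_d -> R) : 'rV[R]_d -> R :=
  foldr partial F s.

Definition monomial (alpha : {ffun 'I_d -> nat}) (x : 'I_d -> R) : R :=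
  \prod_(i < d) x i ^+ alpha i.

(** The first conjunct says that F is C^oo. *)
Definition real_schwartz (F : 'rV[R]_d -> R) : Prop :=
  (forall s (x : 'rV[R]_d), differentiable (partials s F) x) /\
  (forall alpha s, exists M : R, forall x : 'rV[R]_d,
    `|monomial alpha (x 0) * partials s F x| <= M).

Definition schwartz (f : g -> R[i]) : Prop :=
  real_schwartz (fun x : 'rV[R]_d => complex.Re (f (point (x 0)))) /\
  real_schwartz (fun x : 'rV[R]_d => complex.Im (f (point (x 0)))).

(** Integral against c times the Lebesgue measure for which the parallelepiped
    spanned by [X] has volume 1. *)
Definition lie_integral (c : R) (h : g -> R[i]) : R[i] :=
  let mu := lebesgue_tuple R d in
  (c * \int[mu]_t complex.Re (h (point (tnth t)))) +i*
  (c * \int[mu]_t complex.Im (h (point (tnth t)))).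

Definition convolution (br : g -> g -> g) (c : R) (f h : g -> R[i]) :
    g -> R[i] :=
  fun x => lie_integral c (fun y => f (lie_mul br x (lie_inv y)) * h y).

(** (...((f_1 * f_2) * f_3) ... ) * f_n; the empty family gets a dummy value. *)
Definition convolutions (br : g -> g -> g) (c : R) (n : nat)
    (f : 'I_n -> g -> R[i]) : g -> R[i] :=
  if [seq f m | m <- enum 'I_n] is f1 :: fs
  then foldl (convolution br c) f1 fs else fun=> 0.

Definition mulT (alpha : {ffun 'I_d -> nat}) (f : g -> R[i]) : g -> R[i] :=
  fun x => (monomial alpha (fun i => coord X i x))%:C * f x.

Definition structure_constant (br : g -> g -> g) (i j k : 'I_d) : R :=
  coord X k (br (tnth X i) (tnth X j)).

End functions.

(** * The combinatorial coefficients

    Indices are 0-based. *)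

Section combinatorics.
Context {R : realType} {d : nat}.
Variables (a : 'I_d -> 'I_d -> 'I_d -> R) (n : nat).
Implicit Types (alpha : {ffun 'I_d -> nat}).

Definition quintuple : finType :=
  ('I_d * 'I_d * 'I_d * 'I_n * 'I_n)%type.

Definition q_i (q : quintuple) : 'I_d := q.1.1.1.1.
Definition q_j (q : quintuple) : 'I_d := q.1.1.1.2.
Definition q_k (q : quintuple) : 'I_d := q.1.1.2.
Definition q_r (q : quintuple) : 'I_n := q.1.2.
Definition q_s (q : quintuple) : 'I_n := q.2.

Definition Dn : finType :=
  {q : quintuple | (a (q_i q) (q_j q) (q_k q) != 0) && (q_r q < q_s q)%N}.

Implicit Types (tau : {ffun Dn -> nat}) (q : Dn).

Definition tau0 tau : {ffun 'I_d -> nat} :=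
  [ffun k => (\sum_(q : Dn | q_k (val q) == k) tau q)%N].

Definition taum tau (m : 'I_n) : {ffun 'I_d -> nat} :=
  [ffun l =>
    (\sum_(q : Dn | (q_i (val q) == l) && (q_r (val q) == m)) tau q +
     \sum_(q : Dn | (q_j (val q) == l) && (q_s (val q) == m)) tau q)%N].

Definition mfact alpha : nat := (\prod_(i < d) (alpha i)`!)%N.

Definition tau_fact tau : nat := (\prod_(q : Dn) (tau q)`!)%N.

Definition multinomial alpha (beta : {ffun 'I_n -> {ffun 'I_d -> nat}}) tau : R :=
  (mfact alpha)%:R / ((\prod_(m < n) mfact (beta m)) * tau_fact tau)%N%:R.

Definition c_tau tau : R :=
  2^-1 ^+ (\sum_(q : Dn) tau q)%N *
  \prod_(q : Dn) a (q_i (val q)) (q_j (val q)) (q_k (val q)) ^+ tau q.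

Definition madd (alpha beta : {ffun 'I_d -> nat}) : {ffun 'I_d -> nat} :=
  [ffun i => (alpha i + beta i)%N].

(** The pairs (beta, tau) with beta^1 + ... + beta^n + tau_[0] = alpha. *)
Definition decompositions alpha :
    set ({ffun 'I_n -> {ffun 'I_d -> nat}} * {ffun Dn -> nat}) :=
  [set p : {ffun 'I_n -> {ffun 'I_d -> nat}} * {ffun Dn -> nat} |
    forall i, (\sum_(m < n) p.1 m i + tau0 p.2 i)%N = alpha i].

Lemma decompositions_finite alpha : finite_set (decompositions alpha).
Proof.
pose N := (\sum_(i < d) alpha i)%N.
pose T := ({ffun 'I_n -> {ffun 'I_d -> 'I_N.+1}} * {ffun Dn -> 'I_N.+1})%type.
pose phi (u : T) : {ffun 'I_n -> {ffun 'I_d -> nat}} * {ffun Dn -> nat} :=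
  ([ffun m => [ffun i => nat_of_ord (u.1 m i)]], [ffun q => nat_of_ord (u.2 q)]).
apply: (@sub_finite_set _ _ (range phi)); last first.
  by apply: finite_image; exact: finite_finset.
move=> -[beta tau] /= E.
have leN i : (alpha i <= N)%N by rewrite /N (bigD1 i)//= leq_addr.
have lebeta m i : (beta m i < N.+1)%N.
  rewrite ltnS (leq_trans _ (leN i))// -E (bigD1 m)//=.
  by rewrite -addnA leq_addr.
have letau q : (tau q < N.+1)%N.
  rewrite ltnS (leq_trans _ (leN (q_k (val q))))// -E ffunE.
  by rewrite (bigD1 q)//= addnCA leq_addr.
exists ([ffun m => [ffun i => Ordinal (lebeta m i)]], [ffun q => Ordinal (letau q)]) => //.
congr pair; apply/ffunP => y; rewrite !ffunE//=.
by apply/ffunP => i; rewrite !ffunE.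
Qed.

End combinatorics.

Arguments decompositions {R d} a n alpha.

(* Main.v *)
Require Import Defs.
From HB Require Import structures.
From mathcomp Require Import all_boot all_order all_algebra.
From mathcomp Require Import all_classical all_reals all_analysis measurable_realfun.
From mathcomp Require Import complex ring.

(** Why the formula holds.  The value of f_1 * ... * f_n at x is an integral of
    f_1(y^1) ... f_n(y^n) over the factorizations x = y^1 o ... o y^n, and in a
    two-step group such a factorization satisfies

      x_k = sum_m y^m_k + 1/2 sum_(r < s) sum_(i, j) a_(i,j,k) y^r_i y^s_j.

    Expanding x^alpha by the multinomial theorem chooses each linear term
    y^m_k some beta^m_k times and each bracket term (i, j, k, r, s) some
    tau_(i,j,k,r,s) times; the power of y^m collected on the way is
    beta^m + tau_[m].

    The proof never writes the multiple integral.  Multiplication by a single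
    coordinate is computed first: [convolution_coord] does it for two functions,
    straight from x = (x o y^-1) o y, and [convolutions_coord] extends it to n
    functions by induction, the brackets of brackets being killed by
    [structure_constant_nil].  Hence, for fixed x, the numbers
    C_gamma = (T^(gamma^1) f_1 * ... * T^(gamma^n) f_n)(x) satisfy
    x_k C_gamma = sum_s w_s C_(gamma + e_s), where s runs over the terms of x_k
    displayed above ([convolutions_term]).  This recurrence alone implies the
    multinomial formula ([multinomial_expansion]), and it remains to split each
    gamma into its linear part beta and its bracket part tau
    ([decompositions_colorings]).

    These manipulations need the integrals to be additive, hence absolutely
    convergent, for every partial convolution.  Instead of the Schwartz space,
    the induction runs in the larger class [rapidC] of measurable functions all
    of whose monomial multiples are bounded.  It contains the Schwartz functions,
    its members are bounded by multiples of the integrable weight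
    prod_i 1 / (1 + t_i^2), and it is stable under convolution for a purely algebraic reason: by the
    two-function formula, x^alpha (F * G) is a combination of convolutions of
    members of the class, and each of those is bounded. *)

Set Implicit Arguments.
Unset Strict Implicit.
Unset Printing Implicit Defensive.

Import Order.TTheory GRing.Theory Num.Theory.
Import numFieldNormedType.Exports.

Local Open Scope classical_set_scope.
Local Open Scope ring_scope.
Local Open Scope complex_scope.

(* The name [point] alone denotes the default element of a pointed type. *)
Local Notation point := Defs.point.

(** * An integrable weight *)

Section weight.
Context {R : realType}.

Definition weight n (t : Rtuple R n) : R := \prod_(i < n) (oneDsqr (tnth t i))^-1.

Lemma weight_gt0 n (t : Rtuple R n) : 0 < weight t.
Proof. by apply: prodr_gt0 => i _; rewrite invr_gt0 (lt_le_trans ltr01)// oneDsqr_ge1. Qed.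

Lemma measurable_oneDsqrV : measurable_fun setT (fun x : measurableTypeR R => (oneDsqr x)^-1).
Proof. exact: (continuous_measurable_fun (@continuous_oneDsqrV R)). Qed.

Lemma emeasurable_oneDsqrV :
  measurable_fun setT (fun x : measurableTypeR R => ((oneDsqr x)^-1)%:E).
Proof. apply/measurable_EFinP; exact: measurable_oneDsqrV. Qed.

Lemma measurable_weight n : measurable_fun setT (@weight n).
Proof.
apply: measurable_prod => i _.
apply: (measurableT_comp measurable_oneDsqrV).
exact: measurable_tnth.
Qed.

Lemma emeasurable_weight n :
  measurable_fun setT (fun t : Rtuple R n => (weight t)%:E).
Proof. apply/measurable_EFinP. exact: measurable_weight. Qed.

Lemma integral_oneDsqrV_lty :
  (\int[@lebesgue_measure R]_x ((oneDsqr x)^-1)%:E < +oo)%E.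
Proof.
rewrite ge0_symfun_integralT.
- by rewrite -set_itvcy integral0y_oneDsqr -EFinM ltry.
- by move=> x; rewrite invr_ge0 (le_trans ler01)// oneDsqr_ge1.
- exact: continuous_oneDsqrV.
- by move=> x; rewrite /oneDsqr/= sqrrN.
Qed.

Lemma weight_cons n (x : R) (t : Rtuple R n) :
  weight (tcons (x, t)) = (oneDsqr x)^-1 * weight t.
Proof. by rewrite /weight big_ord_recl; congr (_ * _); apply: eq_bigr => i _; rewrite tnthS. Qed.

(** By Tonelli the integral is the n-th power of the integral of 1 / (1 + x^2)
    over the line, which is finite because the arctangent is bounded. *)
Lemma integral_weight_lty n : (\int[lebesgue_tuple R n]_t (weight t)%:E < +oo)%E.
Proof.
elim: n => [|n IH].
  rewrite /= integral_dirac//; last exact: emeasurable_weight.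
  by rewrite diracT mul1e ltry.
rewrite /= /lebesgue_tuple_step ge0_integral_pushforward//=; last 3 first.
- exact: measurable_tcons.
- exact: emeasurable_weight.
- by move=> t _; rewrite lee_fin ltW// weight_gt0.
rewrite preimage_setT.
have mw : measurable_fun setT ((fun t : Rtuple R n.+1 => (weight t)%:E) \o @tcons R n).
  by apply: measurableT_comp; [exact: emeasurable_weight|exact: measurable_tcons].
rewrite (fubini_tonelli1 ((fun t : Rtuple R n.+1 => (weight t)%:E) \o @tcons R n))//; last first.
  by move=> t; rewrite lee_fin ltW// weight_gt0.
rewrite /fubini_F.
under eq_integral => x _.
  under eq_integral => t _ do rewrite /= weight_cons EFinM.
  rewrite ge0_integralZl//; last 2 first.
  - exact: emeasurable_weight.
  - by move=> t _; rewrite lee_fin ltW// weight_gt0.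
  over.
set I := (\int[_]_t _)%E in IH *.
have I0 : (0 <= I)%E by apply: integral_ge0 => t _; rewrite lee_fin ltW// weight_gt0.
have J0 : (0 <= \int[@lebesgue_measure R]_x ((oneDsqr x)^-1)%:E)%E.
  by apply: integral_ge0 => x _; rewrite lee_fin invr_ge0 (le_trans ler01)// oneDsqr_ge1.
rewrite /= ge0_integralZr//; last exact: emeasurable_oneDsqrV.
apply: lte_mul_pinfty => //.
by rewrite ge0_fin_numE//; exact: integral_oneDsqrV_lty.
Qed.

Lemma integrable_weight n : (lebesgue_tuple R n).-integrable setT (EFin \o @weight n).
Proof.
apply/integrableP; split; first exact: emeasurable_weight.
under eq_integral => t _ do rewrite gee0_abs ?lee_fin ?ltW ?weight_gt0//.
exact: integral_weight_lty.
Qed.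

End weight.

(** * Continuous functions of a tuple are measurable *)

Section continuous.
Context {R : realType} {d : nat}.

Definition row_of (t : Rtuple R d) : 'rV[R]_d := \row_i tnth t i.

(** Points of the lattice of mesh 1 / (m + 1); [cell m t] is the integer vector of
    the lattice point just below [t]. *)
Definition grid (m : nat) (z : {ffun 'I_d -> int}) : 'rV[R]_d :=
  \row_i ((z i)%:~R / m.+1%:R).

Definition cell (m : nat) (t : Rtuple R d) : {ffun 'I_d -> int} :=
  [ffun i => Num.floor (m.+1%:R * tnth t i)].

Lemma measurable_cell m z : measurable [set t | cell m t = z].
Proof.
rewrite (_ : [set _ | _] = \bigcap_(i in [set: 'I_d])
    ((fun t : Rtuple R d => m.+1%:R * tnth t i) @^-1`
      `[(z i)%:~R, (z i + 1)%:~R[%classic)); last first.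
  apply/seteqP; split => [t /= <- i _ /=|t /= h].
    by rewrite ffunE in_itv/= floor_itv.
  apply/ffunP => i; rewrite ffunE; apply: floor_def.
  by have := h i I; rewrite /= in_itv.
apply: fin_bigcap_measurable => // i _.
rewrite -[X in measurable X]setTI.
have mi : measurable_fun setT (fun t : Rtuple R d => m.+1%:R * tnth t i).
  apply: measurable_funM; [exact: measurable_cst|exact: measurable_tnth].
by apply: mi => //; exact: measurable_itv.
Qed.

Lemma cvg_grid t : (fun m => grid m (cell m t)) @ \oo --> row_of t.
Proof.
apply/cvg_ballP => e e0.
near=> m.
split => // i j; rewrite /row_of /grid !mxE /cell ffunE /ball/=.
have m0 : 0 < m.+1%:R :> R by [].
have /andP[l r] := floor_itv (m.+1%:R * tnth t j).
set z := Num.floor _ in l r *.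
have me : m.+1%:R^-1 < e by near: m; exact: (near_infty_natSinv_lt (PosNum e0)).
rewrite ger0_norm; last by rewrite subr_ge0 ler_pdivrMr// mulrC.
apply: le_lt_trans me.
rewrite lerBlDr -[X in X + _]mul1r -mulrDl ler_pdivlMr// mulrC ltW//.
by rewrite addrC (lt_le_trans r)// intrD.
Unshelve. all: by end_near.
Qed.

(** The function is the pointwise limit of its values at nearby lattice points.
    These approximations are constant on countably many measurable cells, so
    the product sigma-algebra of tuples need not be compared with the Borel sets
    of the topology of row vectors. *)
Lemma continuous_measurable_tuple (F : 'rV[R]_d -> R) :
  continuous F -> measurable_fun setT (F \o row_of).
Proof.
move=> cF; apply: (@measurable_fun_cvg _ _ _ _ (fun m => F \o grid m \o cell m)).
  move=> m _ Y _; rewrite setTI.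
  rewrite (_ : _ @^-1` _ = \bigcup_(z : {ffun 'I_d -> int})
     (if `[< Y (F (grid m z)) >] then [set t | cell m t = z] else set0)).
    apply: countable_bigcupT_measurable => // z.
    by case: asboolP => _; [exact: measurable_cell|exact: measurable0].
  apply/seteqP; split => [t /= Yt|t [z _]].
    by exists (cell m t) => //; rewrite asboolT.
  by case: asboolP => //= Yz tz; rewrite /preimage/= tz.
move=> t _; apply: continuous_cvg; [exact: cF|exact: cvg_grid].
Qed.

End continuous.

(** * The multinomial theorem *)

Section expansion.
Variables (K : numFieldType) (I S : finType) (col : S -> I).
Implicit Types (al : {ffun I -> nat}) (ga : {ffun S -> nat}).

Definition incr (T : finType) (ga : {ffun T -> nat}) (s : T) : {ffun T -> nat} :=
  [ffun s' => (ga s' + (s' == s))%N].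

(** Multiplicities of the terms [s] that produce the total degree [al], a term
    of colour i counting for the i-th variable. *)
Definition colorings al : set {ffun S -> nat} :=
  [set ga : {ffun S -> nat} | forall i, (\sum_(s | col s == i) ga s)%N = al i].

Lemma colorings_finite al : finite_set (colorings al).
Proof.
pose N := (\sum_i al i)%N.
pose phi (u : {ffun S -> 'I_N.+1}) : {ffun S -> nat} := [ffun s => u s : nat].
apply: (@sub_finite_set _ _ (range phi)); last first.
  by apply: finite_image; exact: finite_finset.
move=> ga /= E.
have le s : (ga s < N.+1)%N.
  rewrite ltnS (@leq_trans (al (col s)))//; last by rewrite /N (bigD1 (col s))//= leq_addr.
  by rewrite -E (bigD1 s)//= leq_addr.
exists [ffun s => Ordinal (le s)] => //.
by apply/ffunP => s; rewrite !ffunE.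
Qed.

Lemma incr_colorings al ga s :
  colorings (incr al (col s)) (incr ga s) <-> colorings al ga.
Proof.
have E i : (\sum_(s' | col s' == i) incr ga s s' =
            \sum_(s' | col s' == i) ga s' + (i == col s))%N.
  under eq_bigr do rewrite ffunE.
  rewrite big_split/=; congr addn.
  case: eqVneq => [->|ne].
    by rewrite (bigD1 s)//= eqxx big1 ?addn0// => s' /andP[_ /negPf ->].
  rewrite big1// => s' /eqP cs'; case: eqVneq => // ss'.
  by rewrite -cs' ss' eqxx in ne.
split=> h i; have := h i; rewrite E ffunE; first by move/addIn.
by move=> ->.
Qed.

Lemma incr_inj (T : finType) (s : T) : injective (@incr T ^~ s).
Proof. by move=> f h /ffunP e; apply/ffunP => s'; have := e s'; rewrite !ffunE => /addIn. Qed.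

Lemma incrK (T : finType) (ga : {ffun T -> nat}) (s : T) : ga s != 0%N ->
  exists ga' : {ffun T -> nat}, ga = incr ga' s.
Proof.
move=> h; exists [ffun s' => (ga s' - (s' == s))%N]; apply/ffunP => s'; rewrite !ffunE.
by case: eqVneq => [->|_]; rewrite ?subnK ?lt0n// subn0 addn0.
Qed.

(** Divided powers are used because raising one exponent then costs only the new
    exponent as a factor, whatever the others are. *)
Lemma divided_power_incr (T : finType) (v : T -> K) (ga : {ffun T -> nat}) s :
  v s * \prod_s' (v s' ^+ ga s' / (ga s')`!%:R) =
  (incr ga s s)%:R * \prod_s' (v s' ^+ incr ga s s' / (incr ga s s')`!%:R).
Proof.
rewrite (bigD1 s)//= [in RHS](bigD1 s)//= !ffunE eqxx addn1 factS exprS natrM.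
rewrite (eq_bigr (fun s' => v s' ^+ incr ga s s' / (incr ga s s')`!%:R)); last first.
  by move=> s' /negPf s's; rewrite ffunE s's addn0.
have n1 : (ga s).+1%:R != 0 :> K by rewrite pnatr_eq0.
have n2 : (ga s)`!%:R != 0 :> K by rewrite pnatr_eq0 -lt0n fact_gt0.
by field; rewrite n2 addrC natr1.
Qed.

Variables (t : I -> K) (w : S -> K) (C : {ffun S -> nat} -> K).
(** [t k] plays the part of the sum of the terms of colour [k], and [C ga] that
    of the monomial of exponents [ga] in the unweighted terms. *)
Hypothesis step : forall k ga, t k * C ga = \sum_(s | col s == k) w s * C (incr ga s).

Let A ga := \prod_s (w s ^+ ga s / (ga s)`!%:R) * C ga.

(** An exponent [ga] of degree al + e_k arises from ga - e_s for each term s of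
    colour k, with the factor ga_s; these factors add up to al_k + 1. *)
Lemma expansion_step al k : t k * (\sum_(ga \in colorings al) A ga) =
  (al k).+1%:R * \sum_(ga \in colorings (incr al k)) A ga.
Proof.
rewrite !mulr_fsumr.
transitivity (\sum_(s | col s == k) \sum_(ga \in colorings al)
    (incr ga s s)%:R * A (incr ga s)).
  rewrite (fsbig_finite _ _ (colorings_finite al))/=.
  under [RHS]eq_bigr do rewrite (fsbig_finite _ _ (colorings_finite al))/=.
  rewrite exchange_big/=; apply: eq_bigr => ga _.
  rewrite mulrCA step mulr_sumr; apply: eq_bigr => s _.
  by rewrite mulrA [in RHS]mulrA -divided_power_incr [w s * _]mulrC.
transitivity (\sum_(s | col s == k) \sum_(ga \in colorings (incr al k)) (ga s)%:R * A ga).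
  apply: eq_bigr => s /eqP <-.
  rewrite -(fsbig_image (colorings al) (@incr S ^~ s) (fun ga => (ga s)%:R * A ga)); last first.
    by move=> x y _ _; exact: (@incr_inj S s).
  apply: fsbig_widen.
    by move=> _ [ga h <-]; apply/incr_colorings.
  (* Exponents that are not increments along s carry the factor ga_s = 0. *)
  move=> ga [h nh] /=; apply/eqP; rewrite mulf_eq0 pnatr_eq0.
  apply: contra_notT nh; rewrite negb_or => /andP[/incrK[ga' gaE] _].
  by exists ga' => //; apply/(@incr_colorings _ _ s); rewrite -gaE.
under eq_bigr do rewrite (fsbig_finite _ _ (colorings_finite _))/=.
rewrite exchange_big/= (fsbig_finite _ _ (colorings_finite _))/=.
apply: eq_big_seq => ga; rewrite in_fset_set ?inE/=; last exact: colorings_finite.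
move=> h; rewrite -mulr_suml -natr_sum (h k) ffunE eqxx addn1//.
Qed.

Lemma expansion_divided al :
  \prod_i (t i ^+ al i / (al i)`!%:R) * C [ffun=> 0%N] = \sum_(ga \in colorings al) A ga.
Proof.
have [n] := ubnP (\sum_i al i)%N; elim: n al => // n IH al; rewrite ltnS => aln.
have [/forallP al0|] := boolP [forall i, al i == 0%N].
  rewrite big1; last by move=> i _; rewrite (eqP (al0 i)) expr0 fact0 divr1.
  rewrite mul1r (_ : colorings al = [set [ffun=> 0%N]]).
    by rewrite fsbig_set1 /A big1 ?mul1r// => s _; rewrite ffunE expr0 fact0 divr1.
  apply/seteqP; split => [ga /= h|_ -> i /=]; last first.
    by rewrite (eqP (al0 i)) big1// => s _; rewrite ffunE.
  apply/ffunP => s; rewrite ffunE; apply/eqP.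
  by have := h (col s); rewrite (eqP (al0 _)) => /eqP; rewrite sum_nat_eq0 => /forall_inP; apply.
rewrite negb_forall => /existsP[k /incrK[be albe]].
have ben : (\sum_i be i < n)%N.
  apply: leq_trans aln; rewrite albe.
  under [ltnRHS]eq_bigr do rewrite ffunE.
  by rewrite big_split/= -[ltnLHS]addn0 ltn_add2l (bigD1 k)//= eqxx.
have n1 : (be k).+1%:R != 0 :> K by rewrite pnatr_eq0.
apply: (mulfI n1); rewrite albe -expansion_step -(IH be ben) !mulrA; congr (_ * _).
by rewrite divided_power_incr ffunE eqxx addn1.
Qed.

(** With commuting variables this is the usual multinomial theorem; stated for a
    solution [C] of the recurrence, it applies to convolutions without a ring of
    polynomials acting on them. *)
Lemma multinomial_expansion al :
  (\prod_i t i ^+ al i) * C [ffun=> 0%N] =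
  \sum_(ga \in colorings al)
    ((\prod_i (al i)`!)%N%:R / (\prod_s (ga s)`!)%N%:R * \prod_s w s ^+ ga s) * C ga.
Proof.
have nf (T : finType) (f : {ffun T -> nat}) : (\prod_i (f i)`!)%N%:R != 0 :> K.
  by rewrite pnatr_eq0 -lt0n prodn_gt0// => i; rewrite fact_gt0.
rewrite -[X in X * _](divfK (nf _ al)) natr_prod -prodf_div mulrAC expansion_divided.
rewrite mulrC mulr_fsumr; apply: eq_fsbigr => ga _.
rewrite /A prodf_div !natr_prod; ring.
Qed.

End expansion.

(** * Group law in coordinates, and rapid decay *)

Section coordinates.
Context {R : realType} {g : vectType R} {d : nat}.
Variables (br : g -> g -> g) (X : d.-tuple g).
Hypotheses (hbr : lie_bracket br) (hnil : two_step_nilpotent br).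
Hypothesis hX : basis_of fullv X.

Local Notation a := (structure_constant X br).

Lemma coordK x : point X (fun i => coord X i x) = x.
Proof.
rewrite /point; under eq_bigr do rewrite (tnth_nth 0).
by rewrite -(coord_basis hX) ?memvf.
Qed.

Lemma pointK k v : coord X k (point X v) = v k.
Proof.
rewrite /point; under eq_bigr do rewrite (tnth_nth 0).
by rewrite coord_sum_free// (basis_free hX).
Qed.

Lemma linear_comb (f : g -> g) (I : finType) (w : I -> R) (v : I -> g) :
  linear f -> f (\sum_i w i *: v i) = \sum_i w i *: f (v i).
Proof.
move=> lf; pose fl : {linear g -> g} := HB.pack f (GRing.isLinear.Build _ _ _ _ f lf).
by rewrite -[f]/(fl : g -> g) linear_sum; under eq_bigr do rewrite linearZ.
Qed.

Lemma coord_br k x y : coord X k (br x y) =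
  \sum_i \sum_j a i j k * coord X i x * coord X j y.
Proof.
rewrite -{1}(coordK x) -{1}(coordK y) /point.
rewrite (linear_comb _ _ (lie_linearl hbr _)) linear_sum; apply: eq_bigr => i _.
rewrite (linear_comb _ _ (lie_linearr hbr _)) linearZ/= linear_sum mulr_sumr.
by apply: eq_bigr => j _; rewrite linearZ/= /structure_constant; ring.
Qed.

Lemma br0l y : br 0 y = 0.
Proof. by have := lie_linearl hbr y (-1) 0 0; rewrite scaler0 addr0 scaleN1r addNr. Qed.

Lemma br0r x : br x 0 = 0.
Proof. by have := lie_linearr hbr x (-1) 0 0; rewrite scaler0 addr0 scaleN1r addNr. Qed.

Lemma brDl x x' y : br (x + x') y = br x y + br x' y.
Proof. by have := lie_linearl hbr y 1 x x'; rewrite !scale1r. Qed.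

Lemma brZl w x y : br (w *: x) y = w *: br x y.
Proof. by have := lie_linearl hbr y w x 0; rewrite br0l !addr0. Qed.

Lemma brNl x y : br (- x) y = - br x y.
Proof. by rewrite -scaleN1r brZl scaleN1r. Qed.

Lemma brNr x y : br x (- y) = - br x y.
Proof. by have := lie_linearr hbr x (-1) y 0; rewrite br0r !addr0 !scaleN1r. Qed.

(** The bracket of [X_i, X_j] with X_l vanishes; in coordinates this removes the
    iterated brackets when one more factor is added to a convolution. *)
Lemma structure_constant_nil i j l m :
  \sum_k a i j k * a k l m = 0.
Proof.
have := congr1 (coord X m) (hnil (tnth X i) (tnth X j) (tnth X l)).
rewrite -{1}(coordK (br (tnth X i) _)) (linear_comb _ _ (lie_linearl hbr _)).
rewrite linear_sum linear0 => E; rewrite -[RHS]E.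
by apply: eq_bigr => k _; rewrite linearZ.
Qed.

Lemma lie_mulVK x y : lie_mul br (lie_mul br x (lie_inv y)) y = x.
Proof.
rewrite /lie_mul /lie_inv !brDl brNl (lie_alternating hbr) subr0 brZl brNr brNl hnil.
by rewrite oppr0 scaler0 addr0 scalerN addrAC subrK subrK.
Qed.

Lemma coord_lie_mul k x y : coord X k (lie_mul br x y) =
  coord X k x + coord X k y + 2^-1 * \sum_i \sum_j a i j k * coord X i x * coord X j y.
Proof. by rewrite /lie_mul !linearD linearZ/= coord_br. Qed.

(** The source of the whole formula: in the integrand of F * G at x the
    arguments are z = x o y^-1 and y, and x = z o y. *)
Lemma coord_split k x y (z := lie_mul br x (lie_inv y)) :
  coord X k x = coord X k z + coord X k y +
    2^-1 * \sum_i \sum_j a i j k * coord X i z * coord X j y.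
Proof. by rewrite -coord_lie_mul lie_mulVK. Qed.

End coordinates.

Section rapid.
Context {R : realType} {g : vectType R} {d : nat}.
Variables (br : g -> g -> g) (X : d.-tuple g).
Hypotheses (hbr : lie_bracket br) (hnil : two_step_nilpotent br).
Hypothesis hX : basis_of fullv X.

Local Notation a := (structure_constant X br).
Local Notation coords x := (fun i => coord X i x).
Local Notation pt t := (point X (tnth t)).

(** Members of this class need not be smooth, so its stability under convolution
    involves no derivative of an integral. *)
Record rapid (u : g -> R) : Prop := Rapid {
  rapid_measurable : measurable_fun setT (fun t : Rtuple R d => u (pt t));
  rapid_monomial : forall alpha, exists M, forall x, `|monomial alpha (coords x) * u x| <= M
}.

Lemma rapidD u v : rapid u -> rapid v -> rapid (u \+ v).
Proof.
move=> [mu du] [mv dv]; split; first exact: measurable_funD.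
move=> al; have [M hM] := du al; have [N hN] := dv al; exists (M + N) => x.
by rewrite /= mulrDr (le_trans (ler_normD _ _))// lerD.
Qed.

Lemma rapidZ w u : rapid u -> rapid (fun x => w * u x).
Proof.
move=> [mu du]; split; first by apply: measurable_funM.
move=> al; have [M hM] := du al; exists (`|w| * M) => x.
by rewrite mulrCA normrM ler_wpM2l.
Qed.

Lemma monomialD (al be : {ffun 'I_d -> nat}) (v : 'I_d -> R) :
  monomial (madd al be) v = monomial al v * monomial be v.
Proof. by rewrite /monomial -big_split; apply: eq_bigr => i _; rewrite ffunE exprD. Qed.

Definition unit_exp (k : 'I_d) : {ffun 'I_d -> nat} := [ffun i => (i == k) : nat].

Lemma monomial_unit k (v : 'I_d -> R) : monomial (unit_exp k) v = v k.
Proof.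
rewrite /monomial (bigD1 k)//= ffunE eqxx expr1 big1 ?mulr1// => i ik.
by rewrite ffunE (negPf ik) expr0.
Qed.

Lemma monomial0 (v : 'I_d -> R) : monomial [ffun=> 0%N] v = 1.
Proof. by rewrite /monomial big1// => i _; rewrite ffunE expr0. Qed.

Lemma rapid_monomialM al u : rapid u -> rapid (fun x => monomial al (coords x) * u x).
Proof.
move=> [mu du]; split.
  apply: measurable_funM => //.
  apply: measurable_prod => i _; apply: measurable_funX.
  under eq_fun do rewrite (pointK hX).
  exact: measurable_tnth.
move=> be; have [M hM] := du (madd be al); exists M => x.
by have := hM x; rewrite monomialD mulrA.
Qed.

Lemma rapid_coord k u : rapid u -> rapid (fun x => coord X k x * u x).
Proof. by move=> /(rapid_monomialM (unit_exp k)); under eq_fun do rewrite monomial_unit. Qed.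

Lemma rapid_bounded u : rapid u -> exists M, forall x, `|u x| <= M.
Proof.
move=> [_ /(_ [ffun=> 0%N])[M hM]]; exists M => x.
by have := hM x; rewrite monomial0 mul1r.
Qed.

(** The reciprocal of the weight is the product of the 1 + t_i^2, that is, a sum of
    monomials indexed by the subsets of coordinates. *)
Lemma rapid_weight u : rapid u -> exists M, forall t : Rtuple R d,
  `|u (pt t)| <= M * weight t.
Proof.
move=> [_ du].
have [M hM] := choice (fun J : {set 'I_d} => du [ffun i => if i \in J then 2 else 0]%N).
exists (\sum_J M J) => t.
rewrite /weight prodfV ler_pdivlMr; last first.
  by apply: prodr_gt0 => i _; rewrite (lt_le_trans ltr01)// oneDsqr_ge1.
rewrite -[\prod_i _]ger0_norm; last first.
  by apply: prodr_ge0 => i _; rewrite (le_trans ler01)// oneDsqr_ge1.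
rewrite -normrM mulrC [\prod_i _](_ : _ = \prod_i (tnth t i ^+ 2 + 1)); last first.
  by apply: eq_bigr => i _; rewrite addrC.
rewrite bigA_distr mulr_suml (le_trans (ler_norm_sum _ _ _))//.
apply: ler_sum => J _; apply: le_trans (hM J (pt t)).
rewrite le_eqVlt; apply/orP; left; apply/eqP; congr (`|_ * _|).
apply: eq_bigr => i _; rewrite ffunE (pointK hX).
by case: ifP; rewrite ?expr0.
Qed.

Local Notation mu := (lebesgue_tuple R d).

(** In coordinates (x, y) |-> x o y^-1 is polynomial, hence measurable jointly in
    both arguments, as Tonelli's theorem requires. *)
Lemma measurable_translate u : rapid u -> measurable_fun setT
  (fun p : Rtuple R d * Rtuple R d => u (lie_mul br (pt p.1) (lie_inv (pt p.2)))).
Proof.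
move=> [mu _].
pose phi (p : Rtuple R d * Rtuple R d) : Rtuple R d :=
  [tuple coord X k (lie_mul br (pt p.1) (lie_inv (pt p.2))) | k < d].
rewrite (_ : (fun _ => _) = (fun t : Rtuple R d => u (pt t)) \o phi); last first.
  apply/funext => p /=; congr u; rewrite -[LHS](coordK hX) /point.
  by apply: eq_bigr => k _; rewrite tnth_mktuple.
apply: measurableT_comp => //.
have m1 k : measurable_fun setT (fun p : Rtuple R d * Rtuple R d => tnth p.1 k).
  by apply: (measurableT_comp (measurable_tnth k)).
have m2 k : measurable_fun setT (fun p : Rtuple R d * Rtuple R d => tnth p.2 k).
  by apply: (measurableT_comp (measurable_tnth k)).
apply/measurable_fun_tnthP => k.
rewrite (_ : _ \o _ = fun p : Rtuple R d * Rtuple R d =>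
  tnth p.1 k - tnth p.2 k + 2^-1 *
    \sum_i \sum_j a i j k * tnth p.1 i * (- tnth p.2 j)); last first.
  apply/funext => p /=; rewrite tnth_mktuple (coord_lie_mul hbr hX).
  rewrite /lie_inv linearN/= !(pointK hX); congr (_ + _ * _).
  by apply: eq_bigr => i _; apply: eq_bigr => j _; rewrite linearN/= !(pointK hX).
apply: measurable_funD; first by apply: measurable_funB; [exact: m1|exact: m2].
apply: measurable_funM => //; apply: measurable_sum => i; apply: measurable_sum => j.
apply: measurable_funM; first by apply: measurable_funM => //; exact: m1.
by apply: measurableT_comp => //; exact: m2.
Qed.

Lemma measurable_translate1 u x : rapid u -> measurable_fun setT
  (fun t : Rtuple R d => u (lie_mul br x (lie_inv (pt t)))).
Proof.
move=> /measurable_translate m.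
pose s : Rtuple R d := [tuple coord X k x | k < d].
have -> : x = pt s.
  by rewrite -[LHS](coordK hX); apply: eq_bigr => k _; rewrite tnth_mktuple.
exact: (measurableT_comp m (pair1_measurable s)).
Qed.

Lemma integrable_conv u v x : rapid u -> rapid v ->
  mu.-integrable setT (EFin \o
    (fun t => u (lie_mul br x (lie_inv (pt t))) * v (pt t))).
Proof.
move=> ru rv; have [M hM] := rapid_bounded ru; have [N hN] := rapid_weight rv.
apply: (@le_integrable _ _ _ _ _ _ _ (EFin \o (fun t => (M * N) * weight t))) => //.
- apply/measurable_EFinP; apply: measurable_funM; first exact: measurable_translate1.
  exact: (rapid_measurable rv).
- move=> t _; rewrite /= lee_fin normrM.
  have M0 : 0 <= M by exact: le_trans (hM 0).
  rewrite [leRHS]ger0_norm.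
    by rewrite -mulrA ler_pM.
  by rewrite -mulrA mulr_ge0// (le_trans _ (hN t)).
- exact: (@integrableZl _ _ _ mu setT measurableT (M * N) _ (integrable_weight d)).
Qed.

End rapid.

(** * Convolution of two real functions *)

Lemma integrable_lincomb d (T : measurableType d) (R : realType)
    (mu : {measure set T -> \bar R}) (I : Type) (s : seq I) (w : I -> R)
    (f : I -> T -> R) : (forall i, mu.-integrable setT (EFin \o f i)) ->
  mu.-integrable setT (EFin \o (fun t => \sum_(i <- s) w i * f i t)).
Proof.
move=> h.
rewrite (_ : _ \o _ = fun t => (\sum_(i <- s) (w i)%:E * (f i t)%:E)%E); last first.
  by apply/funext => t /=; rewrite -sumEFin.
apply: integrable_sum => // i _; exact: (@integrableZl _ _ _ mu setT measurableT _ _ (h i)).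
Qed.

Lemma Rintegral_lincomb d (T : measurableType d) (R : realType)
    (mu : {measure set T -> \bar R}) (I : Type) (s : seq I) (w : I -> R)
    (f : I -> T -> R) : (forall i, mu.-integrable setT (EFin \o f i)) ->
  \int[mu]_t (\sum_(i <- s) w i * f i t) = \sum_(i <- s) w i * \int[mu]_t f i t.
Proof.
move=> h; elim: s => [|i s IH].
  under eq_Rintegral do rewrite big_nil.
  by rewrite big_nil Rintegral_cst// mul0r.
under eq_Rintegral do rewrite big_cons.
rewrite big_cons RintegralD//; last 2 first.
- exact: (@integrableZl _ _ _ mu setT measurableT _ _ (h i)).
- exact: integrable_lincomb.
by rewrite IH RintegralZl.
Qed.

Section real_convolution.
Context {R : realType} {g : vectType R} {d : nat}.
Variables (br : g -> g -> g) (X : d.-tuple g).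
Hypotheses (hbr : lie_bracket br) (hnil : two_step_nilpotent br).
Hypothesis hX : basis_of fullv X.

Local Notation a := (structure_constant X br).
Local Notation pt t := (point X (tnth t)).
Local Notation mu := (lebesgue_tuple R d).
Local Notation rapid := (rapid X).
Implicit Types u v : g -> R.

Definition real_convolution (u v : g -> R) (x : g) : R :=
  \int[mu]_t (u (lie_mul br x (lie_inv (pt t))) * v (pt t)).

Local Notation intconv := (integrable_conv hbr hX).

Lemma real_convolution_suml (I : Type) (s : seq I) (w : I -> R) (u : I -> g -> R) v x :
  (forall i, rapid (u i)) -> rapid v ->
  real_convolution (fun y => \sum_(i <- s) w i * u i y) v x =
  \sum_(i <- s) w i * real_convolution (u i) v x.
Proof.
move=> ru rv; rewrite /real_convolution -Rintegral_lincomb; last by move=> i; exact: intconv.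
by apply: eq_Rintegral => t _; rewrite mulr_suml; apply: eq_bigr => i _; rewrite mulrA.
Qed.

(** [coord_split] integrated term by term. *)
Lemma real_convolution_coord k u v x : rapid u -> rapid v ->
  coord X k x * real_convolution u v x =
  real_convolution (fun y => coord X k y * u y) v x +
  real_convolution u (fun y => coord X k y * v y) x +
  2^-1 * \sum_i \sum_j a i j k *
    real_convolution (fun y => coord X i y * u y) (fun y => coord X j y * v y) x.
Proof.
move=> ru rv; rewrite /real_convolution.
have rcu i := rapid_coord hX i ru; have rcv i := rapid_coord hX i rv.
rewrite -RintegralZl//; last exact: intconv.
rewrite [X in _ + _ * X](_ : _ = \int[mu]_t (\sum_(p : 'I_d * 'I_d) a p.1 p.2 k *
   ((coord X p.1 (lie_mul br x (lie_inv (pt t))) * u (lie_mul br x (lie_inv (pt t)))) *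
    (coord X p.2 (pt t) * v (pt t))))); last first.
  rewrite Rintegral_lincomb; last first.
    by move=> p; exact: (intconv x (rcu p.1) (rcv p.2)).
  by rewrite pair_big.
have iD : mu.-integrable setT (EFin \o (fun t =>
    coord X k (lie_mul br x (lie_inv (pt t))) * u (lie_mul br x (lie_inv (pt t))) * v (pt t)
    + u (lie_mul br x (lie_inv (pt t))) * (coord X k (pt t) * v (pt t)))).
  apply: (integrableD _ (intconv x (rcu k) rv) (intconv x ru (rcv k))) => //.
have iS : mu.-integrable setT (EFin \o (fun t => \sum_(p : 'I_d * 'I_d) a p.1 p.2 k *
   ((coord X p.1 (lie_mul br x (lie_inv (pt t))) * u (lie_mul br x (lie_inv (pt t)))) *
    (coord X p.2 (pt t) * v (pt t))))).
  by apply: integrable_lincomb => p; exact: (intconv x (rcu p.1) (rcv p.2)).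
rewrite -RintegralD//; last 2 first.
- exact: (intconv x (rcu k) rv).
- exact: (intconv x ru (rcv k)).
rewrite -RintegralZl// -RintegralD//; last first.
  exact: (@integrableZl _ _ _ mu setT measurableT _ _ iS).
apply: eq_Rintegral => t _.
rewrite (coord_split hbr hnil hX k x (pt t)).
set z := lie_mul _ _ _; set y := pt t.
rewrite !mulrDl; congr (_ + _ + _).
- by rewrite mulrA.
- by rewrite mulrCA.
rewrite -mulrA pair_big mulr_suml; congr (_ * _).
by apply: eq_bigr => p _; ring.
Qed.

Lemma real_convolution_bounded u v : rapid u -> rapid v ->
  exists M, forall x, `|real_convolution u v x| <= M.
Proof.
move=> ru rv; have [M hM] := rapid_bounded ru; have [N hN] := rapid_weight hX rv.
exists (\int[mu]_t (M * N * weight t)) => x.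
have iuv := intconv x ru rv.
apply: (le_trans (le_normr_Rintegral measurableT iuv)).
apply: le_Rintegral => //.
- exact: (integrable_norm iuv).
- exact: (@integrableZl _ _ _ mu setT measurableT (M * N) _ (integrable_weight d)).
- by move=> t _; rewrite normrM -mulrA ler_pM.
Qed.

Lemma measurable_real_convolution u v : rapid u -> rapid v ->
  measurable_fun setT (fun t : Rtuple R d => real_convolution u v (pt t)).
Proof.
move=> ru rv.
pose f (p : Rtuple R d * Rtuple R d) :=
  (u (lie_mul br (pt p.1) (lie_inv (pt p.2))) * v (pt p.2))%:E.
have mf : measurable_fun setT f.
  apply/measurable_EFinP; apply: measurable_funM; first exact: (measurable_translate hbr hX).
  exact: (measurableT_comp (rapid_measurable rv)).
rewrite (_ : (fun _ => _) = fine \o (fun t => (\int[mu]_s f (t, s))%E)); last by [].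
apply: measurableT_comp => //.
rewrite (_ : (fun _ => _) = fun t : Rtuple R d =>
    (fubini_F mu (f^\+) t - fubini_F mu (f^\-) t)%E); last first.
  apply/funext => t; rewrite integralE /fubini_F; congr (_ - _)%E.
    by apply: eq_integral => s _; rewrite !funeposE.
  by apply: eq_integral => s _; rewrite !funenegE.
apply: emeasurable_funB; apply: measurable_fun_fubini_tonelli_F => //.
- exact: measurable_funepos.
- exact: measurable_funeneg.
Qed.

(** Boundedness of x^alpha (u * v) goes by induction on the degree of alpha for all
    u and v at once: [real_convolution_coord] moves one coordinate of alpha into
    the factors, which stay of rapid decay. *)
Lemma rapid_real_convolution u v : rapid u -> rapid v -> rapid (real_convolution u v).
Proof.
move=> ru rv; split; first exact: measurable_real_convolution.
move=> al; have [n] := ubnP (\sum_i al i)%N.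
elim: n al u v ru rv => // n IH al u v ru rv; rewrite ltnS => aln.
have [/forallP al0|] := boolP [forall i, al i == 0%N].
  have [M hM] := real_convolution_bounded ru rv; exists M => x.
  rewrite (_ : al = [ffun=> 0%N]) ?monomial0 ?mul1r//.
  by apply/ffunP => i; rewrite ffunE; exact/eqP.
rewrite negb_forall => /existsP[k alk].
pose be : {ffun 'I_d -> nat} := [ffun i => (al i - (i == k))%N].
have albe : al = madd be (unit_exp k).
  apply/ffunP => i; rewrite !ffunE; case: eqVneq => [->|_]; last by rewrite subn0 addn0.
  by rewrite subnK// lt0n.
have ben : (\sum_i be i < n)%N.
  apply: leq_trans aln; rewrite albe.
  under [ltnRHS]eq_bigr do rewrite ffunE.
  by rewrite big_split/= -[ltnLHS]addn0 ltn_add2l (bigD1 k)//= ffunE eqxx.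
have rcu i := rapid_coord hX i ru; have rcv i := rapid_coord hX i rv.
have [M1 h1] := IH be _ _ (rcu k) rv ben.
have [M2 h2] := IH be _ _ ru (rcv k) ben.
have [M3 h3] := choice (fun p : 'I_d * 'I_d => IH be _ _ (rcu p.1) (rcv p.2) ben).
exists (M1 + M2 + 2^-1 * \sum_(p : 'I_d * 'I_d) `|a p.1 p.2 k| * M3 p) => x.
rewrite albe monomialD monomial_unit -mulrA real_convolution_coord// !mulrDr.
apply: (le_trans (ler_normD _ _)); apply: lerD.
  by apply: (le_trans (ler_normD _ _)); apply: lerD.
rewrite mulrCA normrM ger0_norm ?invr_ge0//; apply: ler_wpM2l; first by rewrite invr_ge0.
rewrite pair_big mulr_sumr; apply: (le_trans (ler_norm_sum _ _ _)).
by apply: ler_sum => p _; rewrite mulrCA normrM ler_wpM2l.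
Qed.

End real_convolution.

(** * Convolution of two complex functions *)

Section complex_parts.
Context {R : realType}.
Implicit Types z : R[i].

Lemma ReD z z' : complex.Re (z + z') = complex.Re z + complex.Re z'.
Proof. by case: z; case: z'. Qed.

Lemma ImD z z' : complex.Im (z + z') = complex.Im z + complex.Im z'.
Proof. by case: z; case: z'. Qed.

Lemma ReM z z' : complex.Re (z * z') =
  complex.Re z * complex.Re z' - complex.Im z * complex.Im z'.
Proof. by case: z; case: z'. Qed.

Lemma ImM z z' : complex.Im (z * z') =
  complex.Re z * complex.Im z' + complex.Im z * complex.Re z'.
Proof. by case: z; case: z'. Qed.

Lemma ReZ (w : R) z : complex.Re (w%:C * z) = w * complex.Re z.
Proof. by rewrite ReM /= mul0r subr0. Qed.

Lemma ImZ (w : R) z : complex.Im (w%:C * z) = w * complex.Im z.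
Proof. by rewrite ImM /= mul0r addr0. Qed.

Lemma Re_lincomb (I : Type) (s : seq I) (w : I -> R) (F : I -> R[i]) :
  complex.Re (\sum_(i <- s) (w i)%:C * F i) = \sum_(i <- s) w i * complex.Re (F i).
Proof.
elim: s => [|i s IH]; first by rewrite !big_nil.
by rewrite !big_cons ReD ReZ IH.
Qed.

Lemma Im_lincomb (I : Type) (s : seq I) (w : I -> R) (F : I -> R[i]) :
  complex.Im (\sum_(i <- s) (w i)%:C * F i) = \sum_(i <- s) w i * complex.Im (F i).
Proof.
elim: s => [|i s IH]; first by rewrite !big_nil.
by rewrite !big_cons ImD ImZ IH.
Qed.

Lemma complexP z z' : complex.Re z = complex.Re z' -> complex.Im z = complex.Im z' -> z = z'.
Proof. by case: z; case: z' => /= ? ? ? ? -> ->. Qed.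

End complex_parts.

Section convolution.
Context {R : realType} {g : vectType R} {d : nat}.
Variables (br : g -> g -> g) (X : d.-tuple g) (c : R).
Hypotheses (hbr : lie_bracket br) (hnil : two_step_nilpotent br).
Hypothesis hX : basis_of fullv X.

Local Notation a := (structure_constant X br).
Local Notation rapid := (rapid X).
Local Notation conv := (convolution X br c).
Local Notation rconv := (real_convolution br X).
Local Notation Re := (@complex.Re R).
Local Notation Im := (@complex.Im R).
Implicit Types F G : g -> R[i].

Definition rapidC F := rapid (Re \o F) /\ rapid (Im \o F).

Definition mulX (k : 'I_d) F : g -> R[i] := fun x => (coord X k x)%:C * F x.

Lemma Re_mulX k F : Re \o mulX k F = fun x => coord X k x * (Re \o F) x.
Proof. by apply/funext => x; rewrite /= ReZ. Qed.

Lemma Im_mulX k F : Im \o mulX k F = fun x => coord X k x * (Im \o F) x.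
Proof. by apply/funext => x; rewrite /= ImZ. Qed.

Lemma rapidC_mulX k F : rapidC F -> rapidC (mulX k F).
Proof.
by move=> [r i]; split; rewrite ?Re_mulX ?Im_mulX; exact: rapid_coord.
Qed.

Lemma Re_convolution F G x : rapidC F -> rapidC G -> Re (conv F G x) =
  c * (rconv (Re \o F) (Re \o G) x - rconv (Im \o F) (Im \o G) x).
Proof.
move=> [Fr Fi] [Gr Gi]; rewrite /convolution/lie_integral/= /real_convolution; congr (_ * _).
rewrite -RintegralB//; try exact: (integrable_conv hbr hX).
by apply: eq_Rintegral => t _; rewrite ReM.
Qed.

Lemma Im_convolution F G x : rapidC F -> rapidC G -> Im (conv F G x) =
  c * (rconv (Re \o F) (Im \o G) x + rconv (Im \o F) (Re \o G) x).
Proof.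
move=> [Fr Fi] [Gr Gi]; rewrite /convolution/lie_integral/= /real_convolution; congr (_ * _).
rewrite -RintegralD//; try exact: (integrable_conv hbr hX).
by apply: eq_Rintegral => t _; rewrite ImM.
Qed.

Lemma rapidC_convolution F G : rapidC F -> rapidC G -> rapidC (conv F G).
Proof.
move=> rF rG; have [Fr Fi] := rF; have [Gr Gi] := rG; split.
  rewrite (_ : _ \o _ = fun x => c * (rconv (Re \o F) (Re \o G) \+
      (fun x => - 1 * rconv (Im \o F) (Im \o G) x)) x); last first.
    by apply/funext => x; rewrite [LHS]Re_convolution//= mulN1r.
  by apply/rapidZ/rapidD; [|apply: rapidZ]; exact: rapid_real_convolution.
rewrite (_ : _ \o _ = fun x => c * (rconv (Re \o F) (Im \o G) \+
    rconv (Im \o F) (Re \o G)) x); last first.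
  by apply/funext => x; rewrite [LHS]Im_convolution.
by apply/rapidZ/rapidD; exact: rapid_real_convolution.
Qed.

Lemma rapid0 : rapid (fun=> 0).
Proof.
split; first exact: measurable_cst.
by move=> al; exists 0 => x; rewrite mulr0 normr0.
Qed.

Lemma rapid_lincomb (I : Type) (s : seq I) (w : I -> R) (u : I -> g -> R) :
  (forall i, rapid (u i)) -> rapid (fun x => \sum_(i <- s) w i * u i x).
Proof.
move=> ru; elim: s => [|i s IH].
  by under eq_fun do rewrite big_nil; exact: rapid0.
under eq_fun do rewrite big_cons.
exact: (rapidD (rapidZ (w i) (ru i)) IH).
Qed.

Lemma Re_fun_lincomb (I : Type) (s : seq I) (w : I -> R) (F : I -> g -> R[i]) :
  Re \o (fun x => \sum_(i <- s) (w i)%:C * F i x) =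
  fun x => \sum_(i <- s) w i * (Re \o F i) x.
Proof. by apply/funext => x; rewrite /= Re_lincomb. Qed.

Lemma Im_fun_lincomb (I : Type) (s : seq I) (w : I -> R) (F : I -> g -> R[i]) :
  Im \o (fun x => \sum_(i <- s) (w i)%:C * F i x) =
  fun x => \sum_(i <- s) w i * (Im \o F i) x.
Proof. by apply/funext => x; rewrite /= Im_lincomb. Qed.

Lemma rapidC_lincomb (I : Type) (s : seq I) (w : I -> R) (F : I -> g -> R[i]) :
  (forall i, rapidC (F i)) -> rapidC (fun x => \sum_(i <- s) (w i)%:C * F i x).
Proof.
by move=> rF; split; rewrite ?Re_fun_lincomb ?Im_fun_lincomb; apply: rapid_lincomb => i;
  case: (rF i).
Qed.

Lemma convolution_suml (I : Type) (s : seq I) (w : I -> R) (F : I -> g -> R[i]) G x :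
  (forall i, rapidC (F i)) -> rapidC G ->
  conv (fun y => \sum_(i <- s) (w i)%:C * F i y) G x = \sum_(i <- s) (w i)%:C * conv (F i) G x.
Proof.
move=> rF rG; have rS := rapidC_lincomb s w rF; have [Gr Gi] := rG.
have Fr i : rapid (Re \o F i) by case: (rF i).
have Fi i : rapid (Im \o F i) by case: (rF i).
apply: complexP.
  rewrite Re_lincomb Re_convolution// Re_fun_lincomb Im_fun_lincomb.
  rewrite !(real_convolution_suml hbr hX)// -sumrB mulr_sumr.
  by apply: eq_bigr => i _; rewrite Re_convolution//; ring.
rewrite Im_lincomb Im_convolution// Re_fun_lincomb Im_fun_lincomb.
rewrite !(real_convolution_suml hbr hX)// -big_split mulr_sumr.
by apply: eq_bigr => i _; rewrite Im_convolution//=; ring.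
Qed.

Lemma convolution_coord k F G x : rapidC F -> rapidC G ->
  (coord X k x)%:C * conv F G x =
  conv (mulX k F) G x + conv F (mulX k G) x +
  \sum_i \sum_j (2^-1 * a i j k)%:C * conv (mulX i F) (mulX j G) x.
Proof.
move=> rF rG; have [Fr Fi] := rF; have [Gr Gi] := rG.
have rXF i := rapidC_mulX i rF; have rXG i := rapidC_mulX i rG.
rewrite pair_big/=; apply: complexP.
  rewrite ReZ !ReD Re_lincomb !Re_convolution// !Re_mulX !Im_mulX.
  rewrite mulrCA mulrBr !(real_convolution_coord hbr hnil hX)// !pair_big.
  under [in RHS]eq_bigr => p _ do
    rewrite Re_convolution// !Re_mulX !Im_mulX -mulrA [a _ _ _ * _]mulrCA mulrBr mulrCA.
  rewrite -!mulr_sumr sumrB; ring.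
rewrite ImZ !ImD Im_lincomb !Im_convolution// !Re_mulX !Im_mulX.
rewrite mulrCA mulrDr !(real_convolution_coord hbr hnil hX)// !pair_big.
under [in RHS]eq_bigr => p _ do
  rewrite Im_convolution// !Re_mulX !Im_mulX -mulrA [a _ _ _ * _]mulrCA mulrDr mulrCA.
rewrite -!mulr_sumr big_split/=; ring.
Qed.

(** The Schwartz conditions of order zero: the function is differentiable, hence
    continuous and measurable, and its monomial multiples are bounded. *)
Lemma real_schwartz_rapid (u : g -> R) :
  real_schwartz (fun x : 'rV[R]_d => u (point X (x 0))) -> rapid u.
Proof.
move=> [sm dec]; split.
  have cF : continuous (fun x : 'rV[R]_d => u (point X (x 0))).
    by move=> x; apply: differentiable_continuous; exact: (sm [::] x).
  have := continuous_measurable_tuple cF.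
  congr (measurable_fun _ _); apply/funext => t /=; congr u.
  by apply: eq_bigr => i _; rewrite mxE.
move=> al; have [M hM] := dec al [::]; exists M => x.
have := hM (\row_i coord X i x); rewrite /partials/=.
congr (`|_ * u _| <= _).
  by apply: eq_bigr => i _; rewrite mxE.
by rewrite -[RHS](coordK hX); apply: eq_bigr => i _; rewrite mxE.
Qed.

Lemma schwartz_rapidC F : schwartz X F -> rapidC F.
Proof. by move=> [r i]; split; exact: real_schwartz_rapid. Qed.

End convolution.

(** * Convolution of several functions *)

Section convolutions.
Context {R : realType} {g : vectType R} {d : nat}.
Variables (br : g -> g -> g) (X : d.-tuple g) (c : R).
Hypotheses (hbr : lie_bracket br) (hnil : two_step_nilpotent br).
Hypothesis hX : basis_of fullv X.

Local Notation a := (structure_constant X br).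
Local Notation rapidC := (rapidC X).
Local Notation conv := (convolution X br c).
Local Notation convs := (convolutions X br c).

Definition widen_fam (T : Type) n (f : 'I_n.+1 -> T) : 'I_n -> T :=
  fun m => f (widen_ord (leqnSn n) m).

Lemma convolutions1 (f : 'I_1 -> g -> R[i]) : convs f = f ord_max.
Proof.
rewrite /convolutions enum_ordSr (_ : enum 'I_0 = [::])//.
by apply/size0nil; rewrite size_enum_ord.
Qed.

Lemma convolutions_recr n (f : 'I_n.+2 -> g -> R[i]) :
  convs f = conv (convs (widen_fam f)) (f ord_max).
Proof.
rewrite /convolutions enum_ordSr map_rcons -map_comp.
rewrite -[[seq _ | m <- _]]/[seq widen_fam f m | m <- enum 'I_n.+1].
case E : [seq widen_fam f m | m <- enum 'I_n.+1] => [|f1 fs].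
  by have := congr1 size E; rewrite size_map size_enum_ord.
by rewrite /= foldl_rcons.
Qed.

Lemma rapidC_convolutions n (f : 'I_n.+1 -> g -> R[i]) :
  (forall m, rapidC (f m)) -> rapidC (convs f).
Proof.
elim: n f => [|n IH] f rf; first by rewrite convolutions1.
rewrite convolutions_recr; apply: rapidC_convolution => //.
by apply: IH => m; exact: rf.
Qed.

Definition mulX_at n (m : 'I_n) (k : 'I_d) (f : 'I_n -> g -> R[i]) : 'I_n -> g -> R[i] :=
  fun m' => if m' == m then mulX X k (f m') else f m'.

Lemma rapidC_mulX_at n (m : 'I_n) k f : (forall m', rapidC (f m')) ->
  forall m', rapidC (mulX_at m k f m').
Proof. by move=> rf m'; rewrite /mulX_at; case: ifP => _ //; exact: rapidC_mulX. Qed.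

Lemma widen_mulX_at n (m : 'I_n) k f :
  widen_fam (mulX_at (widen_ord (leqnSn n) m) k f) = mulX_at m k (widen_fam f).
Proof. by apply/funext => m'; rewrite /mulX_at /widen_fam -val_eqE. Qed.

Lemma widen_mulX_at_max n k (f : 'I_n.+1 -> g -> R[i]) :
  widen_fam (mulX_at ord_max k f) = widen_fam f.
Proof.
by apply/funext => m'; rewrite /mulX_at /widen_fam -val_eqE /= ltn_eqF.
Qed.

Lemma mulX_at_widen_max n (m : 'I_n) k (f : 'I_n.+1 -> g -> R[i]) :
  mulX_at (widen_ord (leqnSn n) m) k f ord_max = f ord_max.
Proof. by rewrite /mulX_at -val_eqE /= gtn_eqF. Qed.

Lemma mulX_at_max n k (f : 'I_n.+1 -> g -> R[i]) :
  mulX_at ord_max k f ord_max = mulX X k (f ord_max).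
Proof. by rewrite /mulX_at eqxx. Qed.

Local Notation quad n := (('I_d * 'I_d) * ('I_n * 'I_n))%type.

(** An index ((i, j), (r, s)) stands for the term y^r_i y^s_j of the
    bracket [y^r, y^s]; pairs with s <= r get weight 0. *)
Definition bracket_weight n (k : 'I_d) (p : quad n) : R :=
  if (p.2.1 < p.2.2)%N then 2^-1 * a p.1.1 p.1.2 k else 0.

Definition mulX_bracket n (p : quad n) (f : 'I_n -> g -> R[i]) :=
  mulX_at p.2.1 p.1.1 (mulX_at p.2.2 p.1.2 f).

(** The brackets of n + 1 factors are those of the first n, together with those
    whose second factor is the last one. *)
Lemma sum_bracket_recr n k (V : quad n.+1 -> R[i]) :
  \sum_p (bracket_weight k p)%:C * V p =
  \sum_(p : quad n) (bracket_weight k p)%:C *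
     V (p.1, (widen_ord (leqnSn n) p.2.1, widen_ord (leqnSn n) p.2.2)) +
  \sum_i \sum_j \sum_(r < n) (2^-1 * a i j k)%:C *
     V ((i, j), (widen_ord (leqnSn n) r, ord_max)).
Proof.
have E m (F : quad m -> R[i]) : \sum_p F p = \sum_i \sum_j \sum_r \sum_s F ((i, j), (r, s)).
  under [RHS]eq_bigr do under eq_bigr do rewrite pair_bigA.
  by rewrite !pair_bigA; apply: eq_bigr => -[[i j] [r s]].
rewrite !E -big_split; apply: eq_bigr => i _.
rewrite -big_split; apply: eq_bigr => j _.
rewrite big_ord_recr/= [X in _ + X]big1 ?addr0; last first.
  by move=> s _; rewrite /bracket_weight/= ltnNge -ltnS ltn_ord/= mul0r.
rewrite -big_split; apply: eq_bigr => r _.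
by rewrite big_ord_recr/= {2}/bracket_weight/= ltn_ord.
Qed.

(** Induction on the number of factors.  Writing the convolution as F * G with G
    the last function, the two-function formula gives T_k F * G, F * T_k G and
    brackets of T_i F with T_j G; the induction hypothesis expands T_k F and
    T_i F.  In the brackets only the linear part of T_i F survives: its
    bracket part contributes iterated brackets. *)
Lemma convolutions_coord n (f : 'I_n.+1 -> g -> R[i]) k x :
  (forall m, rapidC (f m)) ->
  (coord X k x)%:C * convs f x =
  \sum_m convs (mulX_at m k f) x +
  \sum_p (bracket_weight k p)%:C * convs (mulX_bracket p f) x.
Proof.
elim: n f k x => [|n IH] f k x rf.
  rewrite big_ord1 ord1 [X in _ + X]big1 ?addr0; last first.
    by move=> [ij [r s]] _; rewrite /bracket_weight/= !ord1 ltnn mul0r.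
  by rewrite !convolutions1 /mulX_at ord1 eqxx.
pose F := widen_fam f; pose G := f ord_max.
have rF m : rapidC (F m) by exact: rf.
have rG : rapidC G by exact: rf.
have rcF := rapidC_convolutions rF.
have rFm m k' : rapidC (convs (mulX_at m k' F)).
  by apply: rapidC_convolutions; exact: rapidC_mulX_at.
have rFp p : rapidC (convs (mulX_bracket p F)).
  by apply: rapidC_convolutions; do 2 apply: rapidC_mulX_at.
have rXG j := rapidC_mulX hX j rG.
(* The induction hypothesis convolved with a further function. *)
have IHconv k' H y : rapidC H -> conv (mulX X k' (convs F)) H y =
    \sum_m conv (convs (mulX_at m k' F)) H y +
    \sum_p (bracket_weight k' p)%:C * conv (convs (mulX_bracket p F)) H y.
  move=> rH; pose w (s : 'I_n.+1 + quad n.+1) : R :=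
    match s with inl _ => 1 | inr p => bracket_weight k' p end.
  pose T (s : 'I_n.+1 + quad n.+1) :=
    match s with inl m => convs (mulX_at m k' F) | inr p => convs (mulX_bracket p F) end.
  rewrite (_ : mulX X k' (convs F) = fun z => \sum_s (w s)%:C * T s z).
    rewrite (convolution_suml _ hbr hX)//; last by case=> [m|p]; [exact: rFm|exact: rFp].
    by rewrite big_sumType/=; congr (_ + _); apply: eq_bigr => m _; rewrite rmorph1 mul1r.
  apply/funext => z; rewrite /mulX IH// big_sumType/=; congr (_ + _).
  by apply: eq_bigr => m _; rewrite rmorph1 mul1r.
rewrite convolutions_recr (convolution_coord _ hbr hnil hX)// -/F -/G.
rewrite big_ord_recr sum_bracket_recr/=.
rewrite IHconv// [RHS]addrA [X in X + _ = _]addrAC; congr (_ + _ + _ + _).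
- by apply: eq_bigr => m _; rewrite convolutions_recr widen_mulX_at mulX_at_widen_max.
- by rewrite convolutions_recr widen_mulX_at_max mulX_at_max.
- apply: eq_bigr => p _; rewrite /mulX_bracket/= convolutions_recr.
  by rewrite !widen_mulX_at !mulX_at_widen_max.
under eq_bigr => i _ do under eq_bigr => j _ do rewrite IHconv// mulrDr.
under eq_bigr => i _ do rewrite big_split/=.
rewrite big_split/= [X in _ + X](_ : _ = 0) ?addr0.
  apply: eq_bigr => i _; apply: eq_bigr => j _; rewrite mulr_sumr.
  apply: eq_bigr => r _; rewrite /mulX_bracket/= convolutions_recr.
  by rewrite widen_mulX_at widen_mulX_at_max mulX_at_widen_max mulX_at_max.
(* What remains are the iterated brackets. *)
rewrite exchange_big/= big1// => j _.
under eq_bigr do rewrite mulr_sumr.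
rewrite exchange_big/= big1// => p _.
under eq_bigr do rewrite mulrA -rmorphM.
rewrite -mulr_suml -rmorph_sum/= [X in X%:C](_ : _ = 0) ?mul0r//.
rewrite /bracket_weight; case: (p.2.1 < p.2.2)%N; last by rewrite big1// => i _; rewrite mulr0.
transitivity (2^-1 * 2^-1 * \sum_i a p.1.1 p.1.2 i * a i j k).
  by rewrite mulr_sumr; apply: eq_bigr => i _; ring.
by rewrite structure_constant_nil// mulr0.
Qed.

End convolutions.

(** * Terms of the product in coordinates *)

Section exponents.
Context {R : realType} {g : vectType R} {d : nat}.
Variables (br : g -> g -> g) (X : d.-tuple g).
Hypothesis hX : basis_of fullv X.
Local Notation a := (structure_constant X br).
Local Notation exponent := {ffun 'I_d -> nat}.

Lemma mulT0 (F : g -> R[i]) : mulT X [ffun=> 0%N] F = F.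
Proof. by apply/funext => x; rewrite /mulT monomial0 mul1r. Qed.

Lemma madd_unitE (al : exponent) k l : madd al (unit_exp k) l = (al l + (l == k))%N.
Proof. by rewrite !ffunE. Qed.

Lemma mulT_madd_unit (al : exponent) k (F : g -> R[i]) :
  mulT X (madd al (unit_exp k)) F = mulX X k (mulT X al F).
Proof.
apply/funext => x; rewrite /mulT /mulX monomialD monomial_unit rmorphM/=.
by rewrite mulrAC mulrC.
Qed.

Lemma rapidC_mulT al F : rapidC X F -> rapidC X (mulT X al F).
Proof.
move=> [Fr Fi]; split.
  rewrite (_ : _ \o _ = fun x => monomial al (fun i => coord X i x) * (@complex.Re R \o F) x).
    exact: rapid_monomialM.
  by apply/funext => x; rewrite /= ReZ.
rewrite (_ : _ \o _ = fun x => monomial al (fun i => coord X i x) * (@complex.Im R \o F) x).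
  exact: rapid_monomialM.
by apply/funext => x; rewrite /= ImZ.
Qed.

Lemma mulX_at_mulT n (m : 'I_n) k (e : 'I_n -> exponent) (f : 'I_n -> g -> R[i]) :
  mulX_at X m k (fun m' => mulT X (e m') (f m')) =
  fun m' => mulT X (if m' == m then madd (e m') (unit_exp k) else e m') (f m').
Proof.
by apply/funext => m'; rewrite /mulX_at; case: ifP => _ //; rewrite mulT_madd_unit.
Qed.

Variable n : nat.

(** The terms of the coordinates of y^1 o ... o y^n: [inl (m, i)] is y^m_i and
    [inr (i, j, k, r, s)] is the bracket term of y^r_i and y^s_j in coordinate k. *)
Definition term : finType := ('I_n * 'I_d + Dn a n)%type.

Definition term_coord (s : term) : 'I_d :=
  match s with inl mi => mi.2 | inr q => q_k (val q) end.

Definition term_weight (s : term) : R[i] :=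
  match s with
  | inl _ => 1
  | inr q => (2^-1 * a (q_i (val q)) (q_j (val q)) (q_k (val q)))%:C
  end.

Definition beta_part (ga : {ffun term -> nat}) : {ffun 'I_n -> exponent} :=
  [ffun m => [ffun i => ga (inl (m, i))]].

Definition tau_part (ga : {ffun term -> nat}) : {ffun Dn a n -> nat} :=
  [ffun q => ga (inr q)].

Definition term_exp (ga : {ffun term -> nat}) (m : 'I_n) : exponent :=
  madd (beta_part ga m) (taum (tau_part ga) m).

Lemma sum_tau_incr_inl ga mi (P : pred (Dn a n)) :
  (\sum_(q | P q) tau_part (incr ga (inl mi)) q = \sum_(q | P q) tau_part ga q)%N.
Proof. by apply: eq_bigr => q _; rewrite !ffunE addn0. Qed.

Lemma sum_tau_incr_inr ga (q : Dn a n) (P : pred (Dn a n)) :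
  (\sum_(q' | P q') tau_part (incr ga (inr q)) q' =
   \sum_(q' | P q') tau_part ga q' + P q)%N.
Proof.
rewrite (eq_bigr (fun q' => tau_part ga q' + (q' == q))%N); last first.
  by move=> q' _; rewrite !ffunE.
rewrite big_split/=; congr addn; rewrite big_mkcond (bigD1 q)//= eqxx big1.
  by rewrite addn0; case: (P q).
by move=> q' /negPf->; case: ifP.
Qed.

Lemma term_exp_inl ga m k m' : term_exp (incr ga (inl (m, k))) m' =
  if m' == m then madd (term_exp ga m') (unit_exp k) else term_exp ga m'.
Proof.
apply/ffunP => l.
have -> : term_exp (incr ga (inl (m, k))) m' l =
    (term_exp ga m' l + ((m' == m) && (l == k)))%N.
  by rewrite /term_exp !ffunE !sum_tau_incr_inl addnAC; congr (_ + _ + _)%N.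
by case: eqVneq => _; rewrite ?addn0// madd_unitE.
Qed.

(** One more bracket term raises the exponents of two factors, which is how
    tau_[m] arises. *)
Lemma term_exp_inr ga (q : Dn a n) m l : term_exp (incr ga (inr q)) m l =
  (term_exp ga m l + ((m == q_r (val q)) && (l == q_i (val q))) +
   ((m == q_s (val q)) && (l == q_j (val q))))%N.
Proof.
rewrite /term_exp !ffunE !sum_tau_incr_inr addn0 -!addnA; congr addn; congr addn.
rewrite addnCA.
have swap (T T' : eqType) (u v : T) (u' v' : T') :
    (u == v) && (u' == v') = (v' == u') && (v == u).
  by rewrite andbC [u == v]eq_sym [u' == v']eq_sym.
by rewrite -(swap _ _ m) -(swap _ _ m).
Qed.

(** Brackets with a vanishing structure constant contribute nothing, so only the
    quintuples of D^(n) remain. *)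
Lemma sum_bracket_Dn k (V : ('I_d * 'I_d) * ('I_n * 'I_n) -> R[i]) :
  \sum_p (bracket_weight br X k p)%:C * V p =
  \sum_(q : Dn a n | q_k (val q) == k)
    term_weight (inr q) * V ((q_i (val q), q_j (val q)), (q_r (val q), q_s (val q))).
Proof.
pose A : pred (@quintuple d n) := fun q => (a (q_i q) (q_j q) (q_k q) != 0) && (q_r q < q_s q)%N.
pose F (q : @quintuple d n) := (2^-1 * a (q_i q) (q_j q) (q_k q))%:C *
  V ((q_i q, q_j q), (q_r q, q_s q)).
transitivity (\sum_(q in A | q_k q == k) F q); last exact: big_sub_cond.
pose h (p : ('I_d * 'I_d) * ('I_n * 'I_n)) : @quintuple d n :=
  ((((p.1.1, p.1.2), k), p.2.1), p.2.2).
pose h' (q : @quintuple d n) : ('I_d * 'I_d) * ('I_n * 'I_n) := ((q_i q, q_j q), (q_r q, q_s q)).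
rewrite [RHS](reindex_onto h h'); last first.
  by move=> [[[[i j] k'] r] s] /andP[_ /eqP qk]; rewrite /h /h' /= -qk.
rewrite [RHS]big_mkcond; apply: eq_bigr => -[[i j] [r s]] _.
rewrite /F /h' /h /q_i /q_j /q_k /q_r /q_s /= !eqxx !andbT -topredE /= /A.
rewrite /bracket_weight /q_i /q_j /q_k /q_r /q_s /=.
case: eqVneq => [->|_] /=; first by rewrite mulr0 if_same mul0r.
by case: ifP => //; rewrite mul0r.
Qed.

End exponents.

Section reindexing.
Context {R : realType} {g : vectType R} {d : nat}.
Variables (br : g -> g -> g) (X : d.-tuple g) (n : nat).
Local Notation a := (structure_constant X br).

Lemma term_sums (ga : {ffun term br X n -> nat}) i :
  (\sum_(s | term_coord s == i) ga s =
   \sum_(m < n) beta_part ga m i + tau0 (tau_part ga) i)%N.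
Proof.
rewrite big_sumType/=; congr (_ + _)%N; last first.
  by rewrite ffunE; apply: eq_bigr => q _; rewrite ffunE.
rewrite big_mkcond/=.
rewrite (eq_bigr (fun mi : 'I_n * 'I_d => if mi.2 == i 
    then ga (inl (mi.1, mi.2)) else 0%N)); last first.
  by move=> [m j].
rewrite -(pair_bigA _ (fun m j => if j == i then ga (inl (m, j)) else 0%N))/=.
apply: eq_bigr => m _; rewrite !ffunE (bigD1 i)//= eqxx big1 ?addn0//.
by move=> j /negPf ->.
Qed.

Lemma decompositions_colorings al : set_bij
  (colorings (@term_coord R g d br X n) al) (decompositions a n al)
  (fun ga => (beta_part ga, tau_part ga)).
Proof.
split.
- by move=> ga h i /=; rewrite -term_sums.
- move=> ga ga' _ _ [/ffunP eb /ffunP et]; apply/ffunP => -[[m i]|q].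
    by have /ffunP/(_ i) := eb m; rewrite !ffunE.
  by have := et q; rewrite !ffunE.
move=> [be ta] h /=.
exists [ffun s : term br X n => match s with inl mi => be mi.1 mi.2 | inr q => ta q end].
  move=> i; rewrite term_sums -(h i)/=; congr (_ + _)%N.
    by apply: eq_bigr => m _; rewrite !ffunE.
  by rewrite !ffunE; apply: eq_bigr => q _; rewrite !ffunE.
congr (_, _); apply/ffunP => y; rewrite !ffunE//.
by apply/ffunP => i; rewrite !ffunE.
Qed.

Lemma term_coefficient al (ga : {ffun term br X n -> nat}) :
  (multinomial al (beta_part ga) (tau_part ga) * c_tau (tau_part ga))%:C =
  (\prod_i (al i)`!)%N%:R / (\prod_s (ga s)`!)%N%:R * \prod_s term_weight s ^+ ga s.
Proof.
rewrite rmorphM /multinomial rmorphM fmorphV !rmorph_nat; congr (_ / _%:R * _).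
  rewrite big_sumType/=; congr (_ * _)%N; last first.
    by apply: eq_bigr => q _; rewrite ffunE.
  rewrite (eq_bigr (fun mi : 'I_n * 'I_d => (ga (inl (mi.1, mi.2)))`!)); last by move=> [].
  rewrite -(pair_bigA _ (fun m i => (ga (inl (m, i)))`!))/=.
  by apply: eq_bigr => m _; apply: eq_bigr => i _; rewrite !ffunE.
rewrite big_sumType/= [X in _ = X * _]big1 ?mul1r; last by move=> mi _; rewrite expr1n.
rewrite /c_tau -prodrXr -big_split/= rmorph_prod; apply: eq_bigr => q _.
by rewrite -exprMn rmorphXn ffunE.
Qed.

End reindexing.

(** [convolutions_coord] read on exponents: multiplication by x_k adds to the
    exponents one of the terms of colour k. *)
Lemma convolutions_term (R : realType) (g : vectType R) (br : g -> g -> g)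
    (d : nat) (X : d.-tuple g) (c : R) (n : nat) (f : 'I_n.+1 -> g -> R[i])
    (k : 'I_d) (ga : {ffun term br X n.+1 -> nat}) (x : g) :
  lie_bracket br -> two_step_nilpotent br -> basis_of fullv X ->
  (forall m, rapidC X (f m)) ->
  (coord X k x)%:C * convolutions X br c (fun m => mulT X (term_exp ga m) (f m)) x =
  \sum_(s | term_coord s == k) term_weight s *
    convolutions X br c (fun m => mulT X (term_exp (incr ga s) m) (f m)) x.
Proof.
move=> hbr hnil hX rf.
have {}rf m : rapidC X (mulT X (term_exp ga m) (f m)) by exact: rapidC_mulT.
rewrite (convolutions_coord _ hbr hnil hX)// sum_bracket_Dn big_sumType/=.
congr (_ + _).
  rewrite [RHS]big_mkcond/=.
  rewrite (eq_bigr (fun mi : 'I_n.+1 * 'I_d => if mi.2 == k then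
      convolutions X br c (fun m' => mulT X (term_exp (incr ga (inl (mi.1, mi.2))) m') (f m')) x
      else 0)); last by move=> [m j] _; rewrite mul1r.
  rewrite -(pair_bigA _ (fun m j => if j == k then
      convolutions X br c (fun m' => mulT X (term_exp (incr ga (inl (m, j))) m') (f m')) x
      else 0))/=.
  apply: eq_bigr => m _; rewrite (bigD1 k)//= eqxx big1 ?addr0; last by move=> j /negPf ->.
  rewrite mulX_at_mulT; congr (convolutions X br c _ x); apply/funext => m'.
  by rewrite term_exp_inl.
apply: eq_bigr => q _; congr (_ * convolutions X br c _ x).
rewrite /mulX_bracket !mulX_at_mulT; apply/funext => m'; congr (mulT X _ _).
apply/ffunP => l; rewrite term_exp_inr /=.
by case: (m' == q_r (val q)); case: (m' == q_s (val q));
rewrite /= ?addn0 ?madd_unitE // addnAC.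
Qed.

Theorem proposition3p11 (R : realType) (g : vectType R)
  (br : g -> g -> g) (hbr : lie_bracket br) (hnil : two_step_nilpotent br)
  (delta : R -> g -> g) (hdelta : dilations br delta)
  (d : nat) (X : d.-tuple g) (hX : basis_of fullv X)
  (c : R) (hc : 0 < c)
  (n : nat) (hn : (1 <= n)%N)
  (f : 'I_n -> g -> R[i]) (hf : forall m, schwartz X (f m))
  (alpha : {ffun 'I_d -> nat}) (x : g) :
  let a := structure_constant X br in
  mulT X alpha (convolutions X br c f) x =
  \sum_(p \in decompositions a n alpha)
    (multinomial alpha p.1 p.2 * c_tau p.2)%:C *
    convolutions X br c
      (fun m => mulT X (madd (p.1 m) (taum p.2 m)) (f m)) x.
Proof.
move=> a; case: n hn f hf => // n _ f hf.
rewrite (reindex_fsbig _ _ _ _ (decompositions_colorings br X n.+1 alpha)).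
pose C (ga : {ffun term br X n.+1 -> nat}) :=
  convolutions X br c (fun m => mulT X (term_exp ga m) (f m)) x.
have step k ga : (coord X k x)%:C * C ga =
    \sum_(s | term_coord s == k) term_weight s * C (incr ga s).
  by apply: convolutions_term => // m; exact: (schwartz_rapidC hX).
have := multinomial_expansion step alpha.
have -> : C [ffun=> 0%N] = convolutions X br c f x.
  congr (convolutions X br c _ x); apply/funext => m.
  rewrite (_ : term_exp _ m = [ffun=> 0%N]) ?mulT0//.
  by apply/ffunP => i; rewrite !ffunE !big1// => q _; rewrite !ffunE.
rewrite {1}/mulT (_ : (monomial _ _)%:C = \prod_i (coord X i x)%:C ^+ alpha i); last first.
  by rewrite /monomial rmorph_prod; apply: eq_bigr => i _; rewrite rmorphXn.
move=> ->; apply: eq_fsbigr => ga _.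
by rewrite term_coefficient.
Qed.
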